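(* Under the standing setup below (including the initialisation assumptions and $\|\mathbf{X}\|_2\le R$), there is a constant $C>0$ depending only on $N,d,d_v,K,\epsilon,R$ (not on $\alpha$ or $\mathbf{X}$) such that for every $\alpha>0$ and every $\mathbf{X}\in\mathbb{R}^{N\times d}$ with $\|\mathbf{X}\|_2\le R$ and $\mathbf{M}\neq0$, $$\|\mathbf{J}_1(\mathbf{X})\|_2\le C\alpha,\qquad \mathbf{J}_1(\mathbf{X})=(\mathbf{X}\mathbf{W}^V\mathbf{W}^O\otimes\mathbf{I}_N)^\top\frac{\partial\,\mathrm{vec}\,\mathbf{A}(\mathbf{X})}{\partial\,\mathrm{vec}\,\mathbf{X}}.$$
   Context: Standing setup. Fix integers $N,d,d_v\ge1$ with $2d_v\le d$ and $2d_v\le N$, an integer $K\ge0$ (number of Newton–Schulz iterations), $\epsilon>0$, $R>0$ and a scalar $\alpha>0$. For $\mathbf{X}\in\mathbb{R}^{N\times d}$ and weights $\mathbf{W}^Q,\mathbf{W}^K\in\mathbb{R}^{d\times d_v}$, set $\mathbf{Q}=\mathbf{X}\mathbf{W}^Q$, $\mathbf{K}=\mathbf{X}\mathbf{W}^K$, $\mathbf{M}=[\mathbf{Q},\mathbf{K}]\in\mathbb{R}^{N\times 2d_v}$, $\mathbf{M}_0=\mathbf{M}/(\|\mathbf{M}\|_F+\epsilon)$, $\mathbf{M}_{k+1}=\frac12\mathbf{M}_k(3\mathbf{I}_{2d_v}-\mathbf{M}_k^\top\mathbf{M}_k)$, and $\mathbf{B}=\mathbf{M}_K$. Let $\mathbf{S}=\frac{\alpha}{\sqrt{d_v}}(\mathbf{Q}\mathbf{K}^\top-\mathbf{K}\mathbf{Q}^\top)$,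 $[\mathbf{S}]=\mathbf{B}^\top\mathbf{S}\mathbf{B}\in\mathbb{R}^{2d_v\times2d_v}$, $\mathbf{A}(\mathbf{X})=\mathbf{I}_N+\mathbf{B}(\exp([\mathbf{S}])-\mathbf{I}_{2d_v})\mathbf{B}^\top$, and $\mathrm{OSA}(\mathbf{X})=\mathbf{A}(\mathbf{X})\mathbf{X}\mathbf{W}^V\mathbf{W}^O$ with $\mathbf{W}^V\in\mathbb{R}^{d\times d_v}$, $\mathbf{W}^O\in\mathbb{R}^{d_v\times d}$. Initialisation assumptions: $[\mathbf{W}^Q,\mathbf{W}^K]$ has orthonormal columns, and $\mathbf{W}^V$ and $(\mathbf{W}^O)^\top$ each have orthonormal columns. $\|\cdot\|_2$ is the spectral norm, $\|\cdot\|_F$ the Frobenius norm, $\mathrm{vec}$ column-major vectorisation, $\otimes$ the Kronecker product, and $\partial\,\mathrm{vec}\,F/\partial\,\mathrm{vec}\,\mathbf{X}$ the Jacobian of the vectorised map. *)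

(* Defs.v *)
From HB Require Import structures.
From mathcomp Require Import all_boot all_order all_algebra.
From mathcomp Require Import all_classical all_reals all_analysis.
From mathcomp Require Import mxtens.
Set Implicit Arguments. Unset Strict Implicit. Unset Printing Implicit Defensive.
Import Order.TTheory GRing.Theory Num.Theory.
Import numFieldNormedType.Exports.
Local Open Scope ring_scope.
Local Open Scope classical_set_scope.

Section Defs.
Variable R : realType.

Definition frob {m n : nat} (A : 'M[R]_(m, n)) : R :=
  Num.sqrt (\sum_(i < m) \sum_(j < n) A i j ^+ 2).

Definition specnorm {m n : nat} (A : 'M[R]_(m, n)) : R :=
  sup [set frob (A *m v) | v in [set v : 'cV[R]_n | frob v <= 1]].

Definition expm {n : nat} (A : 'M[R]_n) : 'M[R]_n :=
  limn (fun k : nat => \sum_(i < k) (i`!%:R)^-1 *: A ^+ i).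

(* column-major vectorisation vec : R^{m x n} -> R^{mn}, as a row vector
   (entry A i j sits at index j*m + i) *)
Definition vec {m n : nat} (A : 'M[R]_(m, n)) : 'rV[R]_(n * m) := mxvec A^T.
Definition unvec {m n : nat} (v : 'rV[R]_(n * m)) : 'M[R]_(m, n) := (vec_mx v)^T.

(* Jacobian d vec F / d vec X (rows indexed by outputs, columns by inputs) of
   F : R^{m x n} -> R^{p x q}, at X *)
Definition vecJacobian {m n p q : nat} (F : 'M[R]_(m, n) -> 'M[R]_(p, q))
  (X : 'M[R]_(m, n)) : 'M[R]_(q * p, n * m) :=
  (jacobian (fun v : 'rV[R]_(n * m) => vec (F (unvec v))) (vec X))^T.

Definition vec_differentiable {m n p q : nat} (F : 'M[R]_(m, n) -> 'M[R]_(p, q))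
  (X : 'M[R]_(m, n)) : Prop :=
  differentiable (fun v : 'rV[R]_(n * m) => vec (F (unvec v))) (vec X).

Definition NS_step {N k : nat} (M : 'M[R]_(N, k)) : 'M[R]_(N, k) :=
  2^-1 *: (M *m (3%:M - M^T *m M)).

Section OSA.
Variables (N d dv K : nat) (eps alpha : R).
Variables (WQ WK : 'M[R]_(d, dv)).

Definition Qm (X : 'M[R]_(N, d)) := X *m WQ.
Definition Km (X : 'M[R]_(N, d)) := X *m WK.
Definition Mm (X : 'M[R]_(N, d)) : 'M[R]_(N, dv + dv) := row_mx (Qm X) (Km X).
Definition M0 (X : 'M[R]_(N, d)) := (frob (Mm X) + eps)^-1 *: Mm X.
Definition Bm (X : 'M[R]_(N, d)) := iter K NS_step (M0 X).
Definition Sm (X : 'M[R]_(N, d)) : 'M[R]_N :=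
  (alpha / Num.sqrt (dv%:R)) *: (Qm X *m (Km X)^T - Km X *m (Qm X)^T).
Definition Sproj (X : 'M[R]_(N, d)) : 'M[R]_(dv + dv) :=
  (Bm X)^T *m Sm X *m Bm X.
Definition Am (X : 'M[R]_(N, d)) : 'M[R]_N :=
  1%:M + Bm X *m (expm (Sproj X) - 1%:M) *m (Bm X)^T.
End OSA.

End Defs.

(* Main.v *)
Require Import Defs.
From HB Require Import structures.
From mathcomp Require Import all_boot all_order all_algebra.
From mathcomp Require Import all_classical all_reals all_analysis.
From mathcomp Require Import mxtens ring lra zify.
Set Implicit Arguments. Unset Strict Implicit. Unset Printing Implicit Defensive.
Import Order.TTheory GRing.Theory Num.Theory.
Import numFieldNormedType.Exports.
Local Open Scope ring_scope.
Local Open Scope classical_set_scope.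

(** The derivative of [A] is a sum of three products, each containing either
    [exp [S] - 1] or the derivative of [exp [S]]; every other factor is bounded
    together with its derivative independently of [alpha].  Since [S] is
    skew-symmetric, so is [[S]], and on skew-symmetric matrices [exp] is
    1-Lipschitz for the Frobenius norm: [exp A] is the limit of
    [(1 + A / k) ^ k], where [|(1 + s A) Y|^2 = |Y|^2 + s^2 |A Y|^2], so that
    these powers have norm at most [1 + o(1)] and the differences
    telescope.  Hence both factors are bounded by [[S]] and its derivative, which
    are linear in [alpha], without the factor [exp (alpha C)] that general
    estimates for the exponential would give. *)

(** * The Cauchy-Schwarz inequality and the Frobenius norm *)

Lemma sum_CauchySchwarz (R : realFieldType) (I : finType) (a b : I -> R) :
  (\sum_i a i * b i) ^+ 2 <= (\sum_i a i ^+ 2) * (\sum_i b i ^+ 2).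
Proof.
set A := \sum_i a i ^+ 2; set B := \sum_i b i ^+ 2; set C := \sum_i a i * b i.
have B0 : 0 <= B by apply: sumr_ge0 => i _; exact: sqr_ge0.
(* This sum expands to [B * (A * B - C ^+ 2)]. Dividing by [B] gives the claim when [B != 0]; when
   [B = 0], all [b i] vanish. *)
have : 0 <= \sum_i (B * a i - C * b i) ^+ 2.
  by apply: sumr_ge0 => i _; exact: sqr_ge0.
have -> : \sum_i (B * a i - C * b i) ^+ 2 = B * (A * B - C ^+ 2).
  rewrite (eq_bigr (fun i => B ^+ 2 * a i ^+ 2 + (- (2 * B * C)) * (a i * b i)
             + C ^+ 2 * b i ^+ 2)); last by move=> i _; ring.
  by rewrite !big_split /= -!mulr_sumr -/A -/B -/C; ring.
have [B00 _|Bn0] := eqVneq B 0; last first.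
  by rewrite pmulr_rge0 ?subr_ge0// lt_neqAle eq_sym Bn0.
have b0 i : b i = 0.
  apply/eqP; rewrite -sqrf_eq0; move/eqP: B00; rewrite psumr_eq0; last first.
    by move=> j _; exact: sqr_ge0.
  by move/allP => /(_ i); rewrite mem_index_enum => /(_ isT)/implyP; apply.
by rewrite B00 mulr0 /C big1 ?expr0n//= => i _; rewrite b0 mulr0.
Qed.

Section FrobeniusNorm.
Variable R : realType.

Lemma frob_ge0 m n (A : 'M[R]_(m, n)) : 0 <= frob A.
Proof. exact: sqrtr_ge0. Qed.

Hint Resolve frob_ge0 : core.

Lemma sqr_frob m n (A : 'M[R]_(m, n)) :
  frob A ^+ 2 = \sum_(ij : 'I_m * 'I_n) A ij.1 ij.2 ^+ 2.
Proof.
rewrite sqr_sqrtr; first by rewrite pair_bigA.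
by apply: sumr_ge0 => i _; apply: sumr_ge0 => j _; exact: sqr_ge0.
Qed.

Lemma sqr_frobE m n (A : 'M[R]_(m, n)) :
  frob A ^+ 2 = \sum_i \sum_j A i j ^+ 2.
Proof. by rewrite sqr_frob pair_bigA. Qed.

Lemma frob_le m n (A : 'M[R]_(m, n)) (c : R) :
  0 <= c -> frob A ^+ 2 <= c ^+ 2 -> frob A <= c.
Proof. by move=> c0; rewrite ler_pXn2r// nnegrE. Qed.

Lemma sqr_frob_trace m n (A : 'M[R]_(m, n)) : frob A ^+ 2 = \tr (A^T *m A).
Proof.
rewrite sqr_frobE exchange_big; apply: eq_bigr => j _; rewrite mxE.
by apply: eq_bigr => i _; rewrite mxE expr2.
Qed.

Lemma frob_tr m n (A : 'M[R]_(m, n)) : frob A^T = frob A.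
Proof.
by rewrite /frob exchange_big; congr Num.sqrt; do 2!apply: eq_bigr => ? _; rewrite mxE.
Qed.

Lemma frob0 m n : frob (0 : 'M[R]_(m, n)) = 0.
Proof.
apply/eqP; rewrite -sqrf_eq0 sqr_frob big1// => i _.
by rewrite mxE expr0n.
Qed.

Lemma frob_eq0 m n (A : 'M[R]_(m, n)) : frob A = 0 -> A = 0.
Proof.
move/eqP; rewrite -sqrf_eq0 sqr_frob psumr_eq0; last by move=> i _; exact: sqr_ge0.
move=> /allP A0; apply/matrixP => i j; rewrite mxE.
by have := A0 (i, j); rewrite mem_index_enum => /(_ isT) /=; rewrite sqrf_eq0 => /eqP.
Qed.

Lemma frob_gt0 m n (A : 'M[R]_(m, n)) : A != 0 -> 0 < frob A.
Proof.
by move=> A0; rewrite lt_neqAle frob_ge0 andbT; apply: contra_neq A0 => /esym/frob_eq0.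
Qed.

Lemma frobZ m n (c : R) (A : 'M[R]_(m, n)) : frob (c *: A) = `|c| * frob A.
Proof.
apply/eqP; rewrite -(@eqrXn2 _ 2)// ?mulr_ge0// exprMn real_normK ?num_real//.
rewrite !sqr_frob mulr_sumr; apply/eqP/eq_bigr => i _.
by rewrite mxE exprMn.
Qed.

Lemma frobN m n (A : 'M[R]_(m, n)) : frob (- A) = frob A.
Proof. by rewrite -scaleN1r frobZ normrN1 mul1r. Qed.

Lemma frobD m n (A B : 'M[R]_(m, n)) : frob (A + B) <= frob A + frob B.
Proof.
apply: frob_le; first exact: addr_ge0.
have -> : frob (A + B) ^+ 2 = frob A ^+ 2 + frob B ^+ 2 +
    2 * \sum_(ij : 'I_m * 'I_n) A ij.1 ij.2 * B ij.1 ij.2.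
  rewrite !sqr_frob mulr_sumr -!big_split /=; apply: eq_bigr => i _.
  by rewrite mxE; ring.
have : \sum_(ij : 'I_m * 'I_n) A ij.1 ij.2 * B ij.1 ij.2 <= frob A * frob B.
  apply: le_trans (ler_norm _) _.
  rewrite -(@ler_pXn2r _ 2) ?nnegrE ?mulr_ge0// real_normK ?num_real// exprMn.
  rewrite !sqr_frob; exact: sum_CauchySchwarz.
by rewrite sqrrD; lra.
Qed.

Lemma frob_subC m n (A B : 'M[R]_(m, n)) : frob (A - B) = frob (B - A).
Proof. by rewrite -frobN opprB. Qed.

Lemma frob_dist_dist m n (A B : 'M[R]_(m, n)) :
  `|frob A - frob B| <= frob (A - B).
Proof.
have h (C D : 'M[R]_(m, n)) : frob C <= frob (C - D) + frob D.
  by apply: le_trans (frobD _ _); rewrite subrK.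
have := h A B; have := h B A; rewrite (frob_subC B A) ler_norml; lra.
Qed.

Lemma frob_sum m n (I : Type) (r : seq I) (P : pred I) (F : I -> 'M[R]_(m, n)) :
  frob (\sum_(i <- r | P i) F i) <= \sum_(i <- r | P i) frob (F i).
Proof.
elim/big_ind2 : _ => //; first by rewrite frob0.
by move=> A a B b Aa Bb; apply: le_trans (frobD _ _) _; exact: lerD.
Qed.

Lemma frobM m n p (A : 'M[R]_(m, n)) (B : 'M[R]_(n, p)) :
  frob (A *m B) <= frob A * frob B.
Proof.
apply: frob_le; first exact: mulr_ge0.
(* Transposing [B] groups its squares by columns, so that Cauchy-Schwarz applies to each pair of a
   row of [A] and a column of [B]. *)
rewrite exprMn -[frob B]frob_tr !sqr_frobE mulr_suml; apply: ler_sum => i _.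
rewrite mulr_sumr; apply: ler_sum => j _; rewrite mxE.
apply: le_trans (sum_CauchySchwarz _ _) _.
by under [X in _ <= _ * X]eq_bigr do rewrite mxE.
Qed.

Lemma frobM_le m n p (A : 'M[R]_(m, n)) (B : 'M[R]_(n, p)) a b :
  frob A <= a -> frob B <= b -> frob (A *m B) <= a * b.
Proof. by move=> Aa Bb; apply: le_trans (frobM _ _) _; exact: ler_pM. Qed.

Lemma frob_row_mxE m n p (A : 'M[R]_(m, n)) (B : 'M[R]_(m, p)) :
  frob (row_mx A B) ^+ 2 = frob A ^+ 2 + frob B ^+ 2.
Proof.
rewrite !sqr_frobE -big_split; apply: eq_bigr => i _ /=.
by rewrite big_split_ord /=; congr (_ + _); apply: eq_bigr => j _;
  rewrite ?row_mxEl ?row_mxEr.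
Qed.

Lemma sqr_frob_isometry m n (A : 'M[R]_(m, n)) :
  A^T *m A = 1%:M -> frob A ^+ 2 = n%:R.
Proof. by rewrite sqr_frob_trace => ->; rewrite mxtrace1. Qed.

Lemma frob_isometry m n (A : 'M[R]_(m, n)) :
  A^T *m A = 1%:M -> frob A = Num.sqrt n%:R.
Proof. by move/sqr_frob_isometry <-; rewrite sqrtr_sqr ger0_norm. Qed.

Lemma frob1 n : frob (1%:M : 'M[R]_n) = Num.sqrt n%:R.
Proof. by apply: frob_isometry; rewrite trmx1 mulmx1. Qed.

Lemma mx_norm_le_frob m n (A : 'M[R]_(m, n)) : `|A| <= frob A.
Proof.
rewrite [leLHS]/Num.norm /= mx_normrE; apply/bigmax_leP; split => // -[i j] _ /=.
rewrite -(@ler_pXn2r _ 2) ?nnegrE// real_normK ?num_real// sqr_frob.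
rewrite (bigD1 (i, j))//= lerDl.
by apply: sumr_ge0 => k _; exact: sqr_ge0.
Qed.

Lemma le_mx_norm m n (A : 'M[R]_(m, n)) i j : `|A i j| <= `|A|.
Proof.
by rewrite [leRHS]/Num.norm /= mx_normrE; apply: (le_bigmax _ _ (i, j)).
Qed.

Lemma frob_le_mx_norm m n (A : 'M[R]_(m, n)) : frob A <= (m * n)%:R * `|A|.
Proof.
apply: frob_le; first exact: mulr_ge0.
rewrite sqr_frob exprMn.
apply: (@le_trans _ _ (\sum_(ij : 'I_m * 'I_n) `|A| ^+ 2)).
  apply: ler_sum => -[i j] _ /=.
  by rewrite -[leLHS]real_normK ?num_real// ler_pXn2r ?nnegrE// le_mx_norm.
rewrite sumr_const card_prod !card_ord -[leLHS]mulr_natl.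
apply: ler_wpM2r; first exact: exprn_ge0.
(* The sum has [m * n] terms, and a natural number is at most its square. This crude constant only
   enters proofs of continuity and differentiability. *)
by rewrite -natrX ler_nat; case: (m * n)%N => // k; rewrite leq_pmull.
Qed.

End FrobeniusNorm.
#[export] Hint Extern 0 (is_true (0 <= frob _)) => solve [apply: frob_ge0] : core.

(** * Limits and series of matrices under Frobenius bounds *)

Section FrobeniusLimits.
Variable R : realType.

Lemma frob_continuous m n : continuous (@frob R m n).
Proof.
move=> A; apply/(@cvgrPdist_le _ _ _ (nbhs A)) => e e0.
(* The [+ 1] keeps the constant positive when the matrices are empty. *)
have c0 : 0 < (m * n)%:R + 1 :> R by rewrite ltr_wpDl.
near=> B.
apply: le_trans (frob_dist_dist _ _) _; apply: le_trans (frob_le_mx_norm _) _.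
apply: (@le_trans _ _ (((m * n)%:R + 1) * `|A - B|)).
  by rewrite ler_wpM2r// lerDl.
rewrite -ler_pdivlMl//; near: B; apply: cvgr_dist_le; first exact: cvg_id.
by rewrite mulrC divr_gt0.
Unshelve. all: by end_near. Qed.

Lemma cvg_frob m n (u : nat -> 'M[R]_(m, n)) l :
  u @ \oo --> l -> (fun k => frob (u k)) @ \oo --> frob l.
Proof. by move=> ul; apply: continuous_cvg => //; exact: frob_continuous. Qed.

Lemma frob_lim_le m n (u : nat -> 'M[R]_(m, n)) l b :
  u @ \oo --> l -> (forall k, frob (u k) <= b) -> frob l <= b.
Proof.
move=> /cvg_frob ul ub; rewrite -(cvg_lim _ ul)//.
by apply: limr_le; [exact: cvgP ul|exact: nearW].
Qed.

Lemma frob_cvg0 m n (u : nat -> 'M[R]_(m, n)) (e : nat -> R) :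
  (forall k, frob (u k) <= e k) -> e @ \oo --> 0 -> u @ \oo --> (0 : 'M[R]_(m, n)).
Proof.
move=> ue e0; apply/norm_cvg0P; apply: squeeze_cvgr (cvg_cst 0) e0.
by apply: nearW => k; rewrite normr_ge0/= (le_trans (mx_norm_le_frob _)).
Qed.

Lemma exp_series_le (c : R) k : 0 <= c ->
  \sum_(i < k) c ^+ i / i`!%:R <= expR c.
Proof.
move=> c0; have := is_cvg_series_exp_coeff c => /(nondecreasing_cvgn_le _) h.
rewrite -(big_mkord xpredT (fun i => c ^+ i / i`!%:R)); apply: h.
by apply: nondecreasing_series => i _ _; rewrite /exp_coeff /= divr_ge0// exprn_ge0.
Qed.

(** Blocks of the series are dominated by blocks of the series of norms, so the Cauchy criterion
    carries over; completeness of the matrix space concludes. *)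
Lemma mx_normed_cvg m n (u : nat -> 'M[R]_(m, n)) :
  cvgn [normed series u] -> cvgn (series u).
Proof.
move=> /cauchy_cvgP/cauchy_seriesP uc.
apply/(@cauchy_cvgP 'M[R]_(m, n))/cauchy_seriesP => e /uc.
apply: filterS => -[a b] /=; rewrite ger0_norm ?sumr_ge0//.
by apply: le_lt_trans; apply: ler_norm_sum.
Qed.

(** A scaled exponential majorant suffices for both the exponential series and its termwise
    derivative; [K] collects the factors that do not depend on [i]. *)
Lemma frob_exp_series_cvg m n (u : nat -> 'M[R]_(m, n)) (K c : R) :
  0 <= c -> (forall i, frob (u i) <= K * (c ^+ i / i`!%:R)) -> cvgn (series u).
Proof.
move=> c0 uK; apply: mx_normed_cvg.
have b0 i : 0 <= K * (c ^+ i / i`!%:R) by exact: le_trans (frob_ge0 _) (uK i).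
apply: (series_le_cvg _ b0) => [i|i|] //=.
  exact: le_trans (mx_norm_le_frob _) (uK i).
exact: is_cvg_seriesZ (is_cvg_series_exp_coeff c).
Qed.

Lemma frob_exp_series_le m n (u : nat -> 'M[R]_(m, n)) (K c : R) k :
  0 <= c -> 0 <= K -> (forall i, frob (u i) <= K * (c ^+ i / i`!%:R)) ->
  frob (\sum_(i < k) u i) <= K * expR c.
Proof.
move=> c0 K0 uK; apply: le_trans (frob_sum _ _ _) _.
apply: (@le_trans _ _ (\sum_(i < k) K * (c ^+ i / i`!%:R))).
  exact: ler_sum.
by rewrite -mulr_sumr ler_wpM2l// exp_series_le.
Qed.

End FrobeniusLimits.

(** * The exponential series, its differential and its quadratic remainder *)

Section MatrixExponential.
Variables (R : realType) (n : nat).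
Implicit Types A B T E : 'M[R]_n.

(** This is [sqrt n]: the Frobenius norm of the identity is not one, so every bound on powers
    carries this factor, starting from the empty product. *)
Let kappa : R := frob (1%:M : 'M[R]_n).

Let kappa_ge0 : 0 <= kappa.
Proof. exact: frob_ge0. Qed.

Hint Resolve kappa_ge0 : core.

Lemma frob_mul A B : frob (A * B) <= frob A * frob B.
Proof. exact: frobM. Qed.

Lemma frobX A (c : R) i : frob A <= c -> frob (A ^+ i) <= kappa * c ^+ i.
Proof.
move=> Ac; elim: i => [|i IH]; first by rewrite !expr0 mulr1.
rewrite !exprSr mulrA; apply: le_trans (frob_mul _ _) _.
exact: ler_pM.
Qed.

Lemma frob_exp_term A c i : frob A <= c ->
  frob ((i`!%:R)^-1 *: A ^+ i) <= kappa * (c ^+ i / i`!%:R).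
Proof.
move=> Ac; rewrite frobZ ger0_norm ?invr_ge0// [leLHS]mulrC mulrA.
by rewrite ler_wpM2r ?invr_ge0// frobX.
Qed.

Lemma expm_cvg A :
  (fun k : nat => \sum_(i < k) (i`!%:R)^-1 *: A ^+ i) @ \oo --> expm A.
Proof.
have := @frob_exp_series_cvg R n n _ kappa _ (frob_ge0 A)
  (fun i => frob_exp_term i (lexx (frob A))).
rewrite /expm /series /=; under eq_fun do rewrite big_mkord.
by [].
Qed.

(* [dpow T E i] is the derivative of [X ^+ i] at [T] in the direction [E]. *)
Fixpoint dpow T E (i : nat) : 'M[R]_n :=
  if i is j.+1 then dpow T E j * T + T ^+ j * E else 0.

(** The exponential series differentiated term by term; [expm_taylor2] justifies the exchange. *)
Definition dexpm T E : 'M[R]_n :=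
  limn (fun k : nat => \sum_(i < k) (i`!%:R)^-1 *: dpow T E i).

Lemma dpow_linear T i : linear (fun E => dpow T E i).
Proof.
move=> c E F; elim: i => [|i /= ->]; first by rewrite /= scaler0 addr0.
have mulE (A B : 'M[R]_n) : A * B = A *m B by [].
by rewrite mulrDl mulrDr scalerDr addrACA !mulE scalemxAl scalemxAr.
Qed.

(** Each step of the recursion multiplies the previous bound by [r] and adds a term that [1 <= r]
    makes no larger, whence the base [2 * r]. A geometric bound is weaker than one of order
    [i * r ^+ i.-1], but it fits the exponential majorant. *)
Lemma frob_dpow T E (r : R) i : 1 <= r -> frob T <= r ->
  frob (dpow T E i) <= kappa * frob E * (2 * r) ^+ i.
Proof.
move=> r1 Tr; have r0 : 0 <= r := le_trans ler01 r1.
elim: i => [|i IH]; first by rewrite /= frob0 expr0 mulr1 mulr_ge0.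
rewrite /=; apply: le_trans (frobD _ _) _.
have h1 : frob (dpow T E i * T) <= kappa * frob E * (2 * r) ^+ i * r.
  by apply: le_trans (frob_mul _ _) _; exact: ler_pM.
have h2 : frob (T ^+ i * E) <= kappa * frob E * (2 * r) ^+ i * r.
  apply: le_trans (frob_mul _ _) _.
  apply: (@le_trans _ _ (kappa * r ^+ i * frob E)).
    by rewrite ler_wpM2r// frobX.
  rewrite mulrAC -[leRHS]mulrA ler_wpM2l ?mulr_ge0// -[leLHS]mulr1.
  rewrite ler_pM ?exprn_ge0// lerXn2r ?nnegrE ?mulr_ge0//; lra.
by rewrite [(2 * r) ^+ i.+1]exprSr; lra.
Qed.

Lemma frob_subX T E (r : R) i : 1 <= r -> frob T <= r -> frob (E + T) <= r ->
  frob ((E + T) ^+ i - T ^+ i) <= kappa * frob E * (2 * r) ^+ i.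
Proof.
move=> r1 Tr ETr; have r0 : 0 <= r := le_trans ler01 r1.
elim: i => [|i IH]; first by rewrite subrr frob0 expr0 mulr1 mulr_ge0.
have -> : (E + T) ^+ i.+1 - T ^+ i.+1 =
    ((E + T) ^+ i - T ^+ i) * (E + T) + T ^+ i * E.
  by rewrite !exprSr mulrBl -addrA; congr (_ + _); rewrite mulrDr opprD addrAC addNr add0r.
apply: le_trans (frobD _ _) _.
have h1 : frob (((E + T) ^+ i - T ^+ i) * (E + T)) <=
    kappa * frob E * (2 * r) ^+ i * r.
  by apply: le_trans (frob_mul _ _) _; exact: ler_pM.
have h2 : frob (T ^+ i * E) <= kappa * frob E * (2 * r) ^+ i * r.
  apply: le_trans (frob_mul _ _) _.
  apply: (@le_trans _ _ (kappa * r ^+ i * frob E)).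
    by rewrite ler_wpM2r// frobX.
  rewrite mulrAC -[leRHS]mulrA ler_wpM2l ?mulr_ge0// -[leLHS]mulr1.
  rewrite ler_pM ?exprn_ge0// lerXn2r ?nnegrE ?mulr_ge0//; lra.
by rewrite [(2 * r) ^+ i.+1]exprSr; lra.
Qed.

(** The remainder at [i.+1] is the remainder at [i] times [T], plus [((E + T) ^+ i - T ^+ i) * E],
    which is quadratic in [E] by [frob_subX]. The base [4 * r] absorbs the sum of the two. *)
Lemma frob_subX_dpow T E (r : R) i :
  1 <= r -> frob T <= r -> frob (E + T) <= r ->
  frob ((E + T) ^+ i - T ^+ i - dpow T E i) <=
    kappa * frob E ^+ 2 * (4 * r) ^+ i.
Proof.
move=> r1 Tr ETr; have r0 : 0 <= r := le_trans ler01 r1.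
elim: i => [|i IH]; first by rewrite subrr subr0 frob0 expr0 mulr1 mulr_ge0// exprn_ge0.
have -> : (E + T) ^+ i.+1 - T ^+ i.+1 - dpow T E i.+1 =
    ((E + T) ^+ i - T ^+ i - dpow T E i) * T + ((E + T) ^+ i - T ^+ i) * E.
  rewrite !exprSr /= mulrDr !mulrBl opprD [RHS]addrC !addrA.
  by rewrite !(addrAC _ (- (T ^+ i * E))).
apply: le_trans (frobD _ _) _.
have h1 : frob (((E + T) ^+ i - T ^+ i - dpow T E i) * T) <=
    kappa * frob E ^+ 2 * (4 * r) ^+ i * r.
  by apply: le_trans (frob_mul _ _) _; exact: ler_pM.
have h2 : frob (((E + T) ^+ i - T ^+ i) * E) <=
    kappa * frob E ^+ 2 * (4 * r) ^+ i * r.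
  apply: le_trans (frob_mul _ _) _.
  apply: (@le_trans _ _ (kappa * frob E * (2 * r) ^+ i * frob E)).
    by rewrite ler_wpM2r// frob_subX.
  rewrite mulrAC expr2 !mulrA -[leRHS]mulrA ler_wpM2l ?mulr_ge0// -[leLHS]mulr1.
  rewrite ler_pM ?exprn_ge0// ?mulr_ge0// lerXn2r ?nnegrE ?mulr_ge0//; lra.
have : 0 <= kappa * frob E ^+ 2 * (4 * r) ^+ i * r.
  by rewrite !mulr_ge0// exprn_ge0// mulr_ge0.
by rewrite [(4 * r) ^+ i.+1]exprSr; lra.
Qed.

Lemma frob_scale_fact A (b : R) i : frob A <= b ->
  frob ((i`!%:R)^-1 *: A) <= b / i`!%:R.
Proof.
by move=> Ab; rewrite frobZ ger0_norm ?invr_ge0// mulrC ler_wpM2r// invr_ge0.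
Qed.

Lemma frob_dexp_term T E (r : R) i : 1 <= r -> frob T <= r ->
  frob ((i`!%:R)^-1 *: dpow T E i) <=
    kappa * frob E * ((2 * r) ^+ i / i`!%:R).
Proof. by move=> r1 Tr; rewrite mulrA frob_scale_fact// frob_dpow. Qed.

Lemma dexpm_cvg T E :
  (fun k : nat => \sum_(i < k) (i`!%:R)^-1 *: dpow T E i) @ \oo --> dexpm T E.
Proof.
pose r := frob T + 1.
have r1 : 1 <= r by rewrite lerDr.
have Tr : frob T <= r by rewrite lerDl.
have r0 : 0 <= 2 * r by lra.
have := @frob_exp_series_cvg R n n _ _ _ r0 (fun i => frob_dexp_term E i r1 Tr).
rewrite /dexpm /series /=; under eq_fun do rewrite big_mkord.
by [].
Qed.

(** This gives continuity of the differential. Its exponential growth in [T] does not reach the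
    final constant, which relies on [expm_skew_lipschitz] instead. *)
Lemma frob_dexpm T E :
  frob (dexpm T E) <= kappa * expR (2 * (frob T + 1)) * frob E.
Proof.
have r1 : 1 <= frob T + 1 by rewrite lerDr.
have Tr : frob T <= frob T + 1 by rewrite lerDl.
apply: (frob_lim_le (@dexpm_cvg T E)) => k; rewrite mulrAC.
apply: (@frob_exp_series_le _ _ _ (fun i => (i`!%:R)^-1 *: dpow T E i)).
- by lra.
- exact: mulr_ge0.
- by move=> i; exact: frob_dexp_term.
Qed.

Lemma dexpm_is_linear T : linear (dexpm T).
Proof.
move=> c E F; apply/cvg_lim => //.
have -> : (fun k : nat => \sum_(i < k) (i`!%:R)^-1 *: dpow T (c *: E + F) i) =
   (fun k : nat => c *: (\sum_(i < k) (i`!%:R)^-1 *: dpow T E i) +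
                   \sum_(i < k) (i`!%:R)^-1 *: dpow T F i).
  apply/funext => k; rewrite scaler_sumr -big_split /=; apply: eq_bigr => i _.
  by rewrite dpow_linear scalerDr !scalerA mulrC.
by apply: cvgD; [apply: cvgZl_tmp|]; exact: dexpm_cvg.
Qed.

Lemma expm_taylor2 T E (r : R) :
  1 <= r -> frob T <= r -> frob (E + T) <= r ->
  frob (expm (E + T) - expm T - dexpm T E) <=
    kappa * expR (4 * r) * frob E ^+ 2.
Proof.
move=> r1 Tr ETr.
apply: (frob_lim_le (cvgB (cvgB (@expm_cvg (E + T)) (@expm_cvg T))
  (@dexpm_cvg T E))) => k; rewrite !fctE -!sumrB mulrAC.
under eq_bigr do rewrite -!scalerBr.
apply: (@frob_exp_series_le _ _ _
  (fun i => (i`!%:R)^-1 *: ((E + T) ^+ i - T ^+ i - dpow T E i))).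
- by lra.
- by rewrite mulr_ge0// exprn_ge0.
- by move=> i; rewrite mulrA frob_scale_fact// frob_subX_dpow.
Qed.

End MatrixExponential.

(** * Falling factorials compared with powers *)

Lemma ffact_leX k i : (k ^_ i <= k ^ i)%N.
Proof.
by elim: i => // i IH; rewrite ffactnSr expnSr leq_mul// leq_subr.
Qed.

(** Each of the [i] factors of [k ^_ i] falls short of [k] by less than [i], so the product falls
    short of [k ^ i] by at most [i ^ 2 * k ^ i.-1]. Multiplying by [k] and moving the deficit to the
    right avoids predecessors and truncated subtraction. *)
Lemma leX_ffact k i : (k ^ i.+1 <= k * k ^_ i + i ^ 2 * k ^ i)%N.
Proof.
elim: i => [|i IH]; first by rewrite ffactn0 expn1 muln1 addn0.
(* The last factor is [k - i], truncated at zero; [k <= (k - i) + i] holds also when [k < i]. *)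
have h1 : (k ^_ i * k <= k ^_ i.+1 + i * k ^_ i)%N by rewrite ffactnSr; nia.
have h2 : (k ^_ i * k <= k ^_ i.+1 + i * k ^ i)%N.
  by apply: leq_trans h1 _; rewrite leq_add2l leq_mul2l ffact_leX orbT.
have h3 : (k * (k * k ^_ i) <= k * k ^_ i.+1 + i * k ^ i.+1)%N.
  by rewrite [(k ^ i.+1)%N]expnS mulnCA -mulnDr leq_mul2l [(k * _)%N]mulnC h2 orbT.
rewrite expnS; apply: leq_trans (leq_mul (leqnn k) IH) _.
have -> : (k * (k * k ^_ i + i ^ 2 * k ^ i) =
  k * (k * k ^_ i) + i ^ 2 * k ^ i.+1)%N by rewrite [(k ^ i.+1)%N]expnS; lia.
apply: leq_trans (leq_add h3 (leqnn _)) _.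
rewrite -addnA leq_add2l -mulnDl leq_mul2r; apply/orP; right; nia.
Qed.

(** Makes the polynomial deficit [i ^ 2] geometric, so that it fits an exponential majorant. *)
Lemma sqr_leq_exp4 i : (i ^ 2 <= 4 ^ i)%N.
Proof. by rewrite -[4%N]/(2 ^ 2)%N -expnM mulnC expnM leq_sqr ltnW// ltn_expl. Qed.

(** * Euler approximants and the exponential of skew-symmetric matrices *)

Section SkewExponential.
Variables (R : realType) (n : nat).
Implicit Types A B Y : 'M[R]_n.

Definition skew_sym A := A^T = - A.

(** The shift to [k.+1] avoids division by zero at [k = 0]. *)
Definition euler (k : nat) A : 'M[R]_n := (1 + k.+1%:R^-1 *: A) ^+ k.+1.

(** These are the coefficients of [A ^+ i] in the exponential series and in [euler k A]. Their ratio
    is a falling factorial over a power, which [leX_ffact] places within [i ^ 2 / k.+1] of one. *)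
Lemma binomial_coef_dist (k i : nat) :
  `|(i`!%:R)^-1 - k.+1%:R^-1 ^+ i * 'C(k.+1, i)%:R| <=
  k.+1%:R^-1 * (4 ^+ i / i`!%:R) :> R.
Proof.
have k0 : 0 < k.+1%:R :> R by rewrite ltr0n.
have f0 : 0 < i`!%:R :> R by rewrite ltr0n fact_gt0.
have -> : 'C(k.+1, i)%:R = (k.+1 ^_ i)%:R / i`!%:R :> R.
  by rewrite -bin_ffact natrM mulfK// gt_eqF.
have -> : (i`!%:R)^-1 - k.+1%:R^-1 ^+ i * ((k.+1 ^_ i)%:R / i`!%:R) =
   (1 - (k.+1 ^_ i)%:R / k.+1%:R ^+ i) / i`!%:R :> R.
  by rewrite exprVn; field; rewrite !gt_eqF ?exprn_gt0.
rewrite normrM [X in _ * X <= _]ger0_norm ?invr_ge0// mulrA.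
rewrite ler_wpM2r ?invr_ge0// ger0_norm; last first.
  rewrite subr_ge0 ler_pdivrMr ?exprn_gt0// mul1r -natrX ler_nat.
  exact: ffact_leX.
rewrite lerBlDl -(@ler_pM2r _ (k.+1%:R ^+ i.+1)) ?exprn_gt0// mul1r.
rewrite mulrDl; apply: (@le_trans _ _ (k.+1 * k.+1 ^_ i + i ^ 2 * k.+1 ^ i)%N%:R).
  by rewrite -natrX ler_nat leX_ffact.
rewrite natrD lerD//.
  by rewrite natrM [k.+1%:R ^+ i.+1]exprS mulrCA mulfVK ?gt_eqF ?exprn_gt0.
rewrite natrM !natrX [k.+1%:R ^+ i.+1]exprS mulrACA mulVf ?gt_eqF// mul1r.
by rewrite ler_wpM2r ?exprn_ge0// -!natrX ler_nat sqr_leq_exp4.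
Qed.

Lemma eulerE k A : euler k A =
  \sum_(i < k.+2) (k.+1%:R^-1 ^+ i * 'C(k.+1, i)%:R) *: A ^+ i.
Proof.
rewrite /euler addrC exprDn_comm; last exact: commr1.
rewrite (reindex_inj rev_ord_inj) /=; apply: eq_bigr => i _.
rewrite expr1n mulr1 subSS.
have ik : (i <= k.+1)%N by rewrite -ltnS ltn_ord.
rewrite subKn// bin_sub//.
have -> j : (k.+1%:R^-1 *: A) ^+ j = k.+1%:R^-1 ^+ j *: A ^+ j.
  elim: j => [|j IH]; first by rewrite !expr0 scale1r.
  have mulE (C D : 'M[R]_n) : C * D = C *m D by [].
  by rewrite !exprS IH !mulE -scalemxAl -scalemxAr scalerA.
by rewrite -scaler_nat scalerA mulrC.
Qed.

Lemma euler_cvg A : (fun k => euler k A) @ \oo --> expm A.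
Proof.
pose p k := \sum_(i < k) (i`!%:R)^-1 *: A ^+ i.
(* A partial sum of length [k.+2] has the degree [k.+1] of [euler k A], so the two can be subtracted
   coefficient by coefficient. *)
have pA : (fun k => p k.+2) @ \oo --> expm A.
  by have := @expm_cvg R n A; rewrite -/p -(@cvg_shiftn 2); under eq_fun do rewrite addn2.
have e0 : (fun k => p k.+2 - euler k A) @ \oo --> (0 : 'M[R]_n).
  apply: (@frob_cvg0 _ _ _ _ (fun k =>
    harmonic k * (frob (1%:M : 'M[R]_n) * expR (4 * frob A)))); last first.
    rewrite -[X in _ --> X](mul0r (frob (1%:M : 'M[R]_n) * expR (4 * frob A))).
    by apply: cvgMr_tmp; exact: cvg_harmonic.
  move=> k; rewrite eulerE -sumrB mulrA.
  under eq_bigr do rewrite -scalerBl.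
  apply: (@frob_exp_series_le _ _ _ (fun i => ((i`!%:R)^-1 -
     k.+1%:R^-1 ^+ i * 'C(k.+1, i)%:R) *: A ^+ i)).
  - exact: mulr_ge0.
  - by rewrite mulr_ge0// harmonic_ge0.
  - move=> i; rewrite frobZ.
    apply: le_trans (ler_pM _ _ (binomial_coef_dist k i) (frobX i (lexx _))) _ => //.
    by rewrite /harmonic /= exprMn le_eqVlt; apply/orP; left; apply/eqP; ring.
have <- : (fun k => p k.+2) - (fun k => p k.+2 - euler k A) = euler ^~ A.
  by apply/funext => k; rewrite !fctE subKr.
by rewrite -[expm A]subr0; exact: cvgB.
Qed.

Lemma frob_skew_step A Y (s c : R) : skew_sym A -> frob A <= c ->
  frob ((1 + s *: A) * Y) <= Num.sqrt (1 + s ^+ 2 * c ^+ 2) * frob Y.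
Proof.
move=> sA Ac; have c0 : 0 <= c := le_trans (frob_ge0 A) Ac.
have g0 : 0 <= 1 + s ^+ 2 * c ^+ 2 by rewrite addr_ge0// mulr_ge0// sqr_ge0.
apply: frob_le; first by rewrite mulr_ge0// sqrtr_ge0.
have -> : (1 + s *: A) * Y = Y + s *: (A *m Y) by rewrite mulrDl mul1r scalemxAl.
have -> : frob (Y + s *: (A *m Y)) ^+ 2 = frob Y ^+ 2 + s ^+ 2 * frob (A *m Y) ^+ 2.
  have trE : (Y + s *: (A *m Y))^T = Y^T + s *: (A *m Y)^T.
    by rewrite linearD linearZ.
  rewrite !sqr_frob_trace trE mulmxDl !mulmxDr !mxtraceD -!scalemxAr -!scalemxAl !mxtraceZ.
  (* Skew-symmetry makes the two cross terms cancel. *)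
  have -> : \tr ((A *m Y)^T *m Y) = - \tr (Y^T *m (A *m Y)).
    by rewrite trmx_mul sA mulmxN mulNmx -mulmxA linearN.
  by ring.
rewrite exprMn [Num.sqrt (1 + _) ^+ 2]sqr_sqrtr// mulrDl mul1r lerD2l -[leRHS]mulrA ler_wpM2l ?sqr_ge0//.
by rewrite -exprMn ler_pXn2r ?nnegrE ?mulr_ge0// frobM_le.
Qed.

Lemma frob_skew_stepr A Y (s c : R) : skew_sym A -> frob A <= c ->
  frob (Y * (1 + s *: A)) <= Num.sqrt (1 + s ^+ 2 * c ^+ 2) * frob Y.
Proof.
move=> sA Ac; rewrite -frob_tr -[frob Y]frob_tr.
have -> : (Y * (1 + s *: A))^T = (1 + (- s) *: A) * Y^T.
  rewrite trmx_mul linearD /= linearZ /= sA trmx1 scalerN scaleNr.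
  by [].
by rewrite -(sqrrN s); exact: frob_skew_step.
Qed.

Lemma frob_skew_powr A Y (s c : R) j : skew_sym A -> frob A <= c ->
  frob (Y * (1 + s *: A) ^+ j) <= Num.sqrt (1 + s ^+ 2 * c ^+ 2) ^+ j * frob Y.
Proof.
move=> sA Ac; have := fun Y => @frob_skew_stepr A Y s c sA Ac.
have := sqrtr_ge0 (1 + s ^+ 2 * c ^+ 2); move: (Num.sqrt _) => g g0 step.
elim: j => [|j IH]; first by rewrite !expr0 mulr1 mul1r.
rewrite exprSr mulrA; apply: le_trans (step _) _.
by rewrite [g ^+ _]exprS -mulrA ler_wpM2l.
Qed.

(** The difference telescopes into [j] terms. Each contains one difference of factors, of size
    [s * frob (A - B)], and multiplications that cost at most [g] per factor. *)
Lemma frob_skew_pow_dist A B (s c : R) j : skew_sym A -> skew_sym B ->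
  frob A <= c -> frob B <= c -> 0 <= s ->
  frob ((1 + s *: A) ^+ j - (1 + s *: B) ^+ j) <=
    j%:R * s * frob (A - B) * Num.sqrt (1 + s ^+ 2 * c ^+ 2) ^+ j.
Proof.
move=> sA sB Ac Bc s0; set g := Num.sqrt _.
have g1 : 1 <= g.
  by rewrite -[leLHS]sqrtr1 ler_wsqrtr// lerDl mulr_ge0 ?sqr_ge0.
have g0 : 0 <= g := le_trans ler01 g1.
elim: j => [|j IH]; first by rewrite !expr0 subrr frob0 !mul0r.
set P := 1 + s *: A in IH *; set Q := 1 + s *: B in IH *.
have -> : P ^+ j.+1 - Q ^+ j.+1 = P * (P ^+ j - Q ^+ j) + (P - Q) * Q ^+ j.
  by rewrite !exprS mulrBr mulrBl addrA subrK.
apply: le_trans (frobD _ _) _.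
have h1 : frob (P * (P ^+ j - Q ^+ j)) <=
    g * (j%:R * s * frob (A - B) * g ^+ j).
  by apply: le_trans (frob_skew_step _ _ sA Ac) _; rewrite ler_wpM2l.
have h2 : frob ((P - Q) * Q ^+ j) <= g ^+ j * (s * frob (A - B)).
  apply: le_trans (frob_skew_powr _ _ _ sB Bc) _.
  by rewrite /P /Q opprD addrACA subrr add0r -scalerBr frobZ ger0_norm.
have h3 : g ^+ j * (s * frob (A - B)) <= g * (g ^+ j * (s * frob (A - B))).
  by rewrite ler_peMl// mulr_ge0 ?exprn_ge0 ?mulr_ge0.
have -> : j.+1%:R * s * frob (A - B) * g ^+ j.+1 =
   g * (j%:R * s * frob (A - B) * g ^+ j) + g * (g ^+ j * (s * frob (A - B))).
  by rewrite -[j.+1%:R]natr1 exprS; ring.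
by apply: lerD h1 _; exact: le_trans h2 h3.
Qed.

(** With step [1 / k.+1] and [k.+1] factors, the telescoping prefactor is one. For
    [x = (c / k.+1) ^+ 2], the chain [sqrt (1 + x) <= 1 + x <= expR x] turns the remaining growth
    into a factor tending to one. *)
Lemma frob_euler_dist A B (c : R) k : skew_sym A -> skew_sym B ->
  frob A <= c -> frob B <= c ->
  frob (euler k A - euler k B) <= frob (A - B) * expR (c ^+ 2 * harmonic k).
Proof.
move=> sA sB Ac Bc.
have k0 : 0 < k.+1%:R :> R by rewrite ltr0n.
have s0 : 0 <= k.+1%:R^-1 :> R by rewrite invr_ge0.
apply: le_trans (frob_skew_pow_dist _ sA sB Ac Bc s0) _.
rewrite mulfV ?gt_eqF// mul1r ler_wpM2l//.
set x := _ * c ^+ 2.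
have x0 : 0 <= x by rewrite mulr_ge0 ?sqr_ge0.
have -> : c ^+ 2 * harmonic k = x * k.+1%:R.
  by rewrite /x /harmonic /=; field; rewrite addrC natr1 gt_eqF.
rewrite expRM_natr lerXn2r ?nnegrE ?sqrtr_ge0 ?expR_ge0//.
apply: le_trans (expR_ge1Dx _).
rewrite -(@ler_pXn2r _ 2) ?nnegrE ?sqrtr_ge0 ?addr_ge0// sqr_sqrtr ?addr_ge0//.
by rewrite expr2 ler_peMl ?addr_ge0// lerDl.
Qed.

Lemma expm_skew_lipschitz A B : skew_sym A -> skew_sym B ->
  frob (expm A - expm B) <= frob (A - B).
Proof.
(* The common bound [c] enters only through a factor that tends to one, so the sizes of [A] and [B]
   drop out in the limit. *)
move=> sA sB; pose c := Num.max (frob A) (frob B).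
have h k := @frob_euler_dist A B c k sA sB.
have lhs := cvg_frob (cvgB (@euler_cvg A) (@euler_cvg B)).
have rhs : (fun k => frob (A - B) * expR (c ^+ 2 * harmonic k)) @ \oo -->
    frob (A - B).
  rewrite -[X in _ --> X]mulr1; apply: cvgMl_tmp.
  rewrite -expR0; apply: continuous_cvg; first exact: continuous_expR.
  by rewrite -[X in _ --> X](mulr0 (c ^+ 2)); apply: cvgMl_tmp; exact: cvg_harmonic.
apply: (ler_cvg_to (lhs _) rhs); apply: nearW => k /=; apply: h.
  by rewrite le_max lexx.
by rewrite le_max lexx orbT.
Qed.

Lemma expm0 : expm (0 : 'M[R]_n) = 1%:M.
Proof.
have := @euler_cvg 0; rewrite /euler.
under eq_fun do rewrite scaler0 addr0 expr1n.
by move=> /cvg_lim <- //; rewrite lim_cst.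
Qed.

Lemma frob_expm_sub1 A : skew_sym A -> frob (expm A - 1%:M) <= frob A.
Proof.
move=> sA; rewrite -[leRHS]/(frob A) -{2}[A]subr0 -expm0.
by apply: expm_skew_lipschitz => //; rewrite /skew_sym trmx0 oppr0.
Qed.

End SkewExponential.

(** * Differentiability of the exponential and of matrix products *)

Section Differentiability.
Variable R : realType.

Lemma lipschitz_linear_continuous (V W : normedModType R) (f : {linear V -> W})
  (k : R) : (forall x, `|f x| <= k * `|x|) -> continuous f.
Proof.
move=> fk; apply: bounded_linear_continuous; apply/bounded_funP => r.
exists (`|k| * `|r|) => x xr; apply: le_trans (fk x) _.
apply: (@le_trans _ _ (`|k| * `|x|)); first by rewrite ler_wpM2r// ler_norm.
by rewrite ler_wpM2l//; apply: le_trans xr (ler_norm _).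
Qed.

Lemma frob_linear_continuous m n p q (f : {linear 'M[R]_(m, n) -> 'M[R]_(p, q)})
  (k : R) : (forall A, frob (f A) <= k * frob A) -> continuous f.
Proof.
move=> fk; apply: (@lipschitz_linear_continuous _ _ _ (`|k| * (m * n)%:R)) => A.
apply: le_trans (mx_norm_le_frob _) _; apply: le_trans (fk A) _.
apply: (@le_trans _ _ (`|k| * frob A)); first by rewrite ler_wpM2r// ler_norm.
by rewrite -mulrA ler_wpM2l// frob_le_mx_norm.
Qed.

(** A quadratic remainder near the origin is [o(h)], and uniqueness of the differential identifies
    it with [L]. *)
Lemma is_diff_quadratic (V W : normedModType R) (f : V -> W) (L : {linear V -> W})
  (x : V) (C : R) : continuous L ->
  (forall h, `|h| <= 1 -> `|f (h + x) - f x - L h| <= C * `|h| ^+ 2) ->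
  is_diff x f L.
Proof.
move=> Lc fC.
have fo : f \o shift x = cst (f x) + L +o_ 0 id.
  apply/eqaddoP => e e0; near=> h.
  rewrite !fctE /= opprD addrA.
  have h1 : `|h| <= 1 by near: h; apply: nbhs0_le; exact: ltr01.
  apply: le_trans (fC h h1) _; rewrite expr2 mulrA ler_wpM2r//.
  apply: (@le_trans _ _ ((`|C| + 1) * `|h|)).
    by rewrite ler_wpM2r// (le_trans (ler_norm _))// lerDl.
  rewrite -ler_pdivlMl ?ltr_wpDl//.
  by near: h; apply: nbhs0_le; rewrite mulr_gt0// invr_gt0 ltr_wpDl.
have dE := diff_unique Lc fo.
by apply: DiffDef => //; apply/diff_locallyP; rewrite dE.
Unshelve. all: by end_near. Qed.

Lemma expm_differentiable n (T : 'M[R]_n) : differentiable (@expm R n) T.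
Proof.
(* The constant [c] passes from the entrywise norm to the Frobenius norm; [r] then bounds both [T]
   and [h + T] for all [h] in the unit ball. *)
pose c : R := (n * n)%:R; pose r := frob T + c + 1.
pose K := frob (1%:M : 'M[R]_n) * expR (4 * r).
pose L : {linear 'M[R]_n -> 'M[R]_n} :=
  HB.pack (dexpm T) (GRing.isLinear.Build _ _ _ _ _ (dexpm_is_linear T)).
suff : is_diff T (@expm R n) L by case.
apply: (@is_diff_quadratic _ _ _ _ _ (K * c ^+ 2)).
  exact: (@frob_linear_continuous _ _ _ _ L _ (@frob_dexpm _ _ T)).
move=> h h1; apply: le_trans (mx_norm_le_frob _) _.
have c0 : 0 <= c by [].
have hc : frob h <= c * `|h| := frob_le_mx_norm h.
have hc1 : frob h <= c by apply: le_trans hc _; rewrite ler_piMr.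
apply: (le_trans (@expm_taylor2 _ _ T h r _ _ _)).
- by have := frob_ge0 T; rewrite /r; lra.
- by rewrite /r; lra.
- by apply: le_trans (frobD _ _) _; rewrite /r; lra.
rewrite -/K -mulrA ler_wpM2l//; first by rewrite mulr_ge0// expR_ge0.
by rewrite -exprMn lerXn2r// nnegrE ?mulr_ge0.
Qed.

Lemma mx_norm_mulmx_le m n p (A : 'M[R]_(m, n)) (B : 'M[R]_(n, p)) :
  `|A *m B| <= (m * n)%:R * (n * p)%:R * (`|A| * `|B|).
Proof.
rewrite mulrACA; apply: le_trans (mx_norm_le_frob _) _.
by apply: frobM_le; exact: frob_le_mx_norm.
Qed.

(** The product is the pairing of [f] and [g] followed by a bilinear map, whose first-order
    remainder is exactly [h.1 *m h.2]. *)
Lemma is_diff_mulmx (V : normedModType R) m n p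
  (f df : V -> 'M[R]_(m, n)) (g dg : V -> 'M[R]_(n, p)) (x : V) :
  is_diff x f df -> is_diff x g dg ->
  is_diff x (fun y => f y *m g y) (fun h => f x *m dg h + df h *m g x).
Proof.
move=> dfx dgx.
pose mul (q : 'M[R]_(m, n) * 'M[R]_(n, p)) := q.1 *m q.2.
pose dmul (z q : 'M[R]_(m, n) * 'M[R]_(n, p)) := z.1 *m q.2 + q.1 *m z.2.
have dmul_lin z : linear (dmul z).
  move=> c u v; rewrite /dmul /= mulmxDr mulmxDl -scalemxAr -scalemxAl scalerDr.
  by rewrite addrACA.
pose dmulL z : {linear _ -> _} :=
  HB.pack (dmul z) (GRing.isLinear.Build _ _ _ _ _ (dmul_lin z)).
pose c : R := (m * n)%:R * (n * p)%:R.
have c0 : 0 <= c by rewrite mulr_ge0.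
have dm z : is_diff z mul (dmulL z).
  have n1 (q : 'M[R]_(m, n) * 'M[R]_(n, p)) : `|q.1| <= `|q|.
    by rewrite prod_normE le_max lexx.
  have n2 (q : 'M[R]_(m, n) * 'M[R]_(n, p)) : `|q.2| <= `|q|.
    by rewrite prod_normE le_max lexx orbT.
  apply: (@is_diff_quadratic _ _ _ _ _ c).
    apply: (@lipschitz_linear_continuous _ _ _ (c * `|z.1| + c * `|z.2|)) => q.
    apply: le_trans (ler_normD _ _) _; rewrite mulrDl lerD//.
      apply: le_trans (mx_norm_mulmx_le _ _) _.
      by rewrite -/c -mulrA ler_wpM2l// ler_wpM2l.
    apply: le_trans (mx_norm_mulmx_le _ _) _.
    by rewrite -/c -mulrA ler_wpM2l// mulrC ler_wpM2l.
  move=> h _; rewrite /mul /= /dmul /=.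
  have -> : (h.1 + z.1) *m (h.2 + z.2) - z.1 *m z.2 -
     (z.1 *m h.2 + h.1 *m z.2) = h.1 *m h.2.
    rewrite mulmxDl !mulmxDr [z.1 *m h.2 + z.1 *m z.2]addrC !addrA addrAC.
    rewrite opprD addrA; apply/eqP; rewrite !subr_eq; apply/eqP.
    by rewrite -!addrA; congr (_ + _); rewrite addrC addrA.
  apply: le_trans (mx_norm_mulmx_le _ _) _.
  by rewrite -/c ler_wpM2l// expr2 ler_pM.
have := @is_diff_comp _ _ _ _ _ _ _ _ _ (is_diff_pair dfx dgx) (dm (f x, g x)).
exact.
Qed.

(* The directional difference quotients of f are dominated by those of g. *)
Lemma frob_diff_le (V : normedModType R) m n p q (f : V -> 'M[R]_(m, n))
  (g : V -> 'M[R]_(p, q)) (x h : V) (k : R) :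
  differentiable f x -> differentiable g x ->
  (forall y, frob (f y - f x) <= k * frob (g y - g x)) ->
  frob ('d f x h) <= k * frob ('d g x h).
Proof.
move=> df dg fg; rewrite -!deriveE//.
have quot_cvg m' n' (u : V -> 'M[R]_(m', n')) : differentiable u x ->
    (fun t => frob (t^-1 *: ((u \o shift x) (t *: h) - u x))) @ 0^' -->
      frob ('D_h u x).
  move=> du; apply: continuous_cvg; first exact: frob_continuous.
  exact: diff_derivable du.
apply: (ler_cvg_to (quot_cvg _ _ _ df)
  (@cvgMl_tmp _ _ _ _ _ k _ (quot_cvg _ _ _ dg))).
by near=> t => /=; rewrite !frobZ mulrCA ler_wpM2l.
Unshelve. all: by end_near. Qed.

End Differentiability.

(** * A calculus of bounds on values and differentials *)

Section BoundedDifferential.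
Variables (R : realType) (p : nat).

(** Value and differential are bounded together at one point because the product rule needs both;
    the constants then compose mechanically along a formula. *)
Definition dbound m n (f : 'rV[R]_p -> 'M[R]_(m, n)) (x : 'rV[R]_p) (b l : R) :=
  [/\ differentiable f x, frob (f x) <= b &
      forall h, frob ('d f x h) <= l * frob h].

Lemma is_diff_dbound m n (f df : 'rV[R]_p -> 'M[R]_(m, n)) x b l :
  is_diff x f df -> frob (f x) <= b -> (forall h, frob (df h) <= l * frob h) ->
  dbound f x b l.
Proof. by case=> fx dfE fb dfl; split => // h; rewrite dfE. Qed.

Lemma dbound_linear m n (f : {linear 'rV[R]_p -> 'M[R]_(m, n)}) x b l :
  frob (f x) <= b -> (forall h, frob (f h) <= l * frob h) -> dbound f x b l.
Proof.
move=> fb fl; have fc := frob_linear_continuous fl.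
by split; rewrite ?diff_lin//; exact: linear_differentiable.
Qed.

Lemma dbound_cst m n (A : 'M[R]_(m, n)) x : dbound (cst A) x (frob A) 0.
Proof.
apply: is_diff_dbound (is_diff_cst _ _) _ _ => // h.
by rewrite mul0r frob0.
Qed.

Lemma dbound_comp_linear m n m' n' (f : {linear 'M[R]_(m, n) -> 'M[R]_(m', n')})
    (k : R) g x b l : 0 <= k -> (forall A, frob (f A) <= k * frob A) ->
  dbound g x b l -> dbound (f \o g) x (k * b) (k * l).
Proof.
move=> k0 fk [dg gb gl]; have fc := frob_linear_continuous fk.
have df : differentiable f (g x) by exact: linear_differentiable.
split; first exact: differentiable_comp.
  by apply: le_trans (fk _) _; rewrite ler_wpM2l.
move=> h; rewrite diff_comp// /= diff_lin//; apply: le_trans (fk _) _.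
by rewrite -mulrA ler_wpM2l.
Qed.

Lemma dbound_tr m n (f : 'rV[R]_p -> 'M[R]_(m, n)) x b l :
  dbound f x b l -> dbound (fun y => (f y)^T) x b l.
Proof.
rewrite -[b]mul1r -[l]mul1r => /(@dbound_comp_linear _ _ _ _ trmx 1).
by rewrite !mul1r; apply=> // A; rewrite frob_tr mul1r.
Qed.

Lemma dboundZ m n (f : 'rV[R]_p -> 'M[R]_(m, n)) k x b l : 0 <= k ->
  dbound f x b l -> dbound (fun y => k *: f y) x (k * b) (k * l).
Proof.
move=> k0; apply: (@dbound_comp_linear _ _ _ _ ( *:%R k)) => // A.
by rewrite frobZ ger0_norm.
Qed.

Lemma dboundD m n (f g : 'rV[R]_p -> 'M[R]_(m, n)) x b l b' l' :
  dbound f x b l -> dbound g x b' l' ->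
  dbound (fun y => f y + g y) x (b + b') (l + l').
Proof.
move=> [df fb fl] [dg gb gl].
have H := is_diffD (differentiableP df) (differentiableP dg).
apply: is_diff_dbound H _ _; first by apply: le_trans (frobD _ _) _; exact: lerD.
move=> h; apply: le_trans (frobD _ _) _.
by rewrite [leRHS]mulrDl; apply: lerD; [exact: fl|exact: gl].
Qed.

Lemma dboundN m n (f : 'rV[R]_p -> 'M[R]_(m, n)) x b l :
  dbound f x b l -> dbound (fun y => - f y) x b l.
Proof.
move=> [df fb fl]; have H := is_diffN (differentiableP df).
apply: is_diff_dbound H _ _ => [|h]; first by rewrite (frobN (f x)).
by rewrite (frobN ('d f x h)).
Qed.

Lemma dboundB m n (f g : 'rV[R]_p -> 'M[R]_(m, n)) x b l b' l' :
  dbound f x b l -> dbound g x b' l' ->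
  dbound (fun y => f y - g y) x (b + b') (l + l').
Proof. by move=> Hf /dboundN; exact: dboundD Hf. Qed.

Lemma dboundM m n q (f : 'rV[R]_p -> 'M[R]_(m, n)) (g : 'rV[R]_p -> 'M[R]_(n, q))
    x b l b' l' :
  dbound f x b l -> dbound g x b' l' ->
  dbound (fun y => f y *m g y) x (b * b') (b * l' + l * b').
Proof.
move=> [df fb fl] [dg gb gl].
have H := is_diff_mulmx (differentiableP df) (differentiableP dg).
apply: is_diff_dbound H _ _; first exact: frobM_le.
move=> h; apply: le_trans (frobD _ _) _; rewrite [leRHS]mulrDl.
apply: lerD; first by rewrite -[leRHS]mulrA; apply: frobM_le fb (gl h).
by rewrite [leRHS]mulrAC; apply: frobM_le (fl h) gb.
Qed.

(** Handles the normalisation and the exponential, where a Lipschitz estimate is sharper or simpler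
    than a formula for the differential. Only comparisons with the base point [x] are needed. *)
Lemma dbound_lipschitz m n m' n' (f : 'rV[R]_p -> 'M[R]_(m, n))
    (g : 'rV[R]_p -> 'M[R]_(m', n')) x b l b' k :
  0 <= k -> differentiable f x -> frob (f x) <= b' -> dbound g x b l ->
  (forall y, frob (f y - f x) <= k * frob (g y - g x)) ->
  dbound f x b' (k * l).
Proof.
move=> k0 df fb [dg gb gl] fg; split => // h.
by apply: le_trans (frob_diff_le _ df dg fg) _; rewrite -mulrA ler_wpM2l.
Qed.

End BoundedDifferential.

(** * The normalisation that starts the Newton-Schulz iteration *)

Section Normalisation.
Variable R : realType.

Definition frob_normalize (eps : R) m n (A : 'M[R]_(m, n)) : 'M[R]_(m, n) :=
  (frob A + eps)^-1 *: A.

Lemma frob_normalize_le1 (eps : R) m n (A : 'M[R]_(m, n)) : 0 < eps ->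
  frob (frob_normalize eps A) <= 1.
Proof.
move=> e0; have a0 : 0 < frob A + eps by rewrite ltr_wpDl.
by rewrite frobZ gtr0_norm ?invr_gt0// ler_pdivrMl// mulr1 lerDl ltW.
Qed.

Lemma frob_normalize_lipschitz (eps : R) m n (A B : 'M[R]_(m, n)) : 0 < eps ->
  frob (frob_normalize eps A - frob_normalize eps B) <= 2 / eps * frob (A - B).
Proof.
move=> e0; have a0 : 0 < frob A + eps by rewrite ltr_wpDl.
have b0 : 0 < frob B + eps by rewrite ltr_wpDl.
have ae : (frob A + eps)^-1 <= eps^-1 by rewrite lef_pV2 ?posrE// lerDr.
(* Splits the change into that of the numerator and that of the denominator; each contributes
   [eps^-1 * frob (A - B)]. *)
have -> : frob_normalize eps A - frob_normalize eps B =
    (frob A + eps)^-1 *: (A - B) +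
    ((frob A + eps)^-1 * (frob B - frob A)) *: frob_normalize eps B.
  rewrite /frob_normalize scalerA scalerBr -addrA; congr (_ + _).
  rewrite -scaleNr -scalerDl -scaleNr; congr (_ *: B).
  by field; rewrite !gt_eqF.
apply: le_trans (frobD _ _) _.
rewrite (frobZ _ (A - B)) (frobZ _ (frob_normalize eps B)) normrM.
rewrite [`|(frob A + eps)^-1|]gtr0_norm ?invr_gt0//.
have -> : 2 / eps * frob (A - B) =
  eps^-1 * frob (A - B) + eps^-1 * frob (A - B) * 1 by ring.
apply: lerD; first by rewrite ler_wpM2r.
have i0 : 0 <= (frob A + eps)^-1 by rewrite invr_ge0 ltW.
apply: ler_pM => //; [exact: mulr_ge0| |exact: frob_normalize_le1].
by apply: ler_pM => //; rewrite frob_subC; exact: frob_dist_dist.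
Qed.

(** The square root is differentiable away from zero; this is where the assumption that [Mm WQ WK X]
    is nonzero enters. *)
Lemma differentiable_frob (V : normedModType R) m n (f : V -> 'M[R]_(m, n)) x :
  differentiable f x -> f x != 0 -> differentiable (fun y => frob (f y)) x.
Proof.
move=> df fx0.
pose s y := \sum_(i < m) \sum_(j < n) f y i j ^+ 2.
have ds : differentiable s x.
  have -> : s = \sum_(i < m) \sum_(j < n) (fun y => f y i j) ^+ 2.
    apply/funext => y; rewrite /s fct_sumE; apply: eq_bigr => i _.
    by rewrite fct_sumE; apply: eq_bigr => j _; rewrite exprfctE.
  apply: differentiable_sum => i; apply: differentiable_sum => j.
  apply: differentiableX.
  exact: (differentiable_comp df (differentiable_coord _ _ _)).
have -> : (fun y => frob (f y)) = Num.sqrt \o s by [].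
apply: differentiable_comp ds _; apply/derivable1_diffP.
have sx0 : 0 < s x by rewrite /s -(sqr_frobE (f x)) exprn_gt0// frob_gt0.
by have [] := is_derive1_sqrt sx0.
Qed.

Lemma differentiable_normalize (eps : R) (V : normedModType R) m n
    (f : V -> 'M[R]_(m, n)) x :
  0 < eps -> differentiable f x -> f x != 0 ->
  differentiable (fun y => frob_normalize eps (f y)) x.
Proof.
move=> e0 df fx0.
have ds : differentiable (fun y => (frob (f y) + eps)^-1) x.
  apply: differentiableV; last by rewrite gt_eqF// ltr_wpDl.
  exact: (differentiableD (differentiable_frob df fx0) (differentiable_cst eps x)).
(* Writing the scalar as a multiple of the identity lets the matrix product rule apply. *)
have dk := differentiableZl (1%:M : 'M[R]_m) ds.
have [H _] := is_diff_mulmx (differentiableP dk) (differentiableP df).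
move: H; congr (differentiable _ x); apply/funext => y.
by rewrite -scalemxAl mul1mx.
Qed.

End Normalisation.

(** * Spectral norm against Frobenius norm, and Kronecker products *)

Section SpectralNorm.
Variable R : realType.

Lemma specnorm_le m n (A : 'M[R]_(m, n)) (c : R) :
  (forall v : 'cV[R]_n, frob v <= 1 -> frob (A *m v) <= c) -> specnorm A <= c.
Proof.
move=> Ac; apply: ge_sup; last by move=> _ [v v1 <-]; exact: Ac.
by exists (frob (A *m (0 : 'cV[R]_n))), 0 => //=; rewrite frob0.
Qed.

Lemma frob_mulmx_specnorm m n (A : 'M[R]_(m, n)) (v : 'cV[R]_n) :
  frob v <= 1 -> frob (A *m v) <= specnorm A.
Proof.
move=> v1; apply: ub_le_sup; last by exists v.
exists (frob A) => _ [u u1 <-]; apply: le_trans (frobM _ _) _.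
by rewrite ler_piMr.
Qed.

(** Each of the [n] columns is the image of a unit vector, hence has norm at most [c]. *)
Lemma frob_le_specnorm m n (A : 'M[R]_(m, n)) (c : R) : 0 <= c ->
  specnorm A <= c -> frob A <= Num.sqrt n%:R * c.
Proof.
move=> c0 Ac; apply: frob_le; first by rewrite mulr_ge0// sqrtr_ge0.
rewrite sqr_frobE exprMn sqr_sqrtr// exchange_big /=.
apply: (@le_trans _ _ (\sum_(j < n) c ^+ 2)); last first.
  by rewrite sumr_const card_ord mulr_natl.
apply: ler_sum => j _.
have -> : \sum_i A i j ^+ 2 = frob (A *m delta_mx j (0 : 'I_1)) ^+ 2.
  by rewrite -colE sqr_frobE; apply: eq_bigr => i _; rewrite big_ord1 mxE.
rewrite lerXn2r ?nnegrE//; apply: le_trans Ac; apply: frob_mulmx_specnorm.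
apply: frob_le => //; rewrite expr1n sqr_frobE (bigD1 j)//= big_ord1 mxE !eqxx.
by rewrite expr1n big1 ?addr0// => i ij; rewrite big_ord1 mxE (negbTE ij) expr0n.
Qed.

Lemma frob_tens m n p q (A : 'M[R]_(m, n)) (B : 'M[R]_(p, q)) :
  frob (A *t B) = frob A * frob B.
Proof.
apply/eqP; rewrite -(@eqrXn2 _ 2)// ?mulr_ge0// exprMn !sqr_frobE mulr_sum.
apply/eqP; apply: eq_bigr => i _; rewrite mulr_sum; apply: eq_bigr => j _.
by rewrite mxE exprMn.
Qed.

End SpectralNorm.

(** * Vectorisation as an isometry, and Jacobians *)

Section Vectorisation.
Variable R : realType.

Lemma vecK m n : cancel (@vec R m n) (@unvec R m n).
Proof. by move=> A; rewrite /vec /unvec mxvecK trmxK. Qed.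

Lemma unvecK m n : cancel (@unvec R m n) (@vec R m n).
Proof. by move=> v; rewrite /vec /unvec trmxK vec_mxK. Qed.

Lemma vec_is_linear m n : linear (@vec R m n).
Proof. by move=> c A B; rewrite /vec !linearP. Qed.

Lemma unvec_is_linear m n : linear (@unvec R m n).
Proof. by move=> c A B; rewrite /unvec !linearP. Qed.

Lemma frob_vec m n (A : 'M[R]_(m, n)) : frob (vec A) = frob A.
Proof.
apply/eqP; rewrite -(@eqrXn2 _ 2)// -[frob A]frob_tr; apply/eqP.
rewrite sqr_frobE big_ord1 sqr_frob (reindex _ (curry_mxvec_bij _ _)) /=.
by apply: eq_bigr => -[i j] _ /=; rewrite mxvecE.
Qed.

Lemma frob_unvec m n (v : 'rV[R]_(n * m)) : frob (unvec v : 'M[R]_(m, n)) = frob v.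
Proof. by rewrite -frob_vec unvecK. Qed.

(** Since [vec] preserves the Frobenius norm, the bound on the differential passes to the Jacobian;
    the transposes reconcile row-vector inputs with the column-vector convention. *)
Lemma vecJacobian_bound m n p q (F : 'M[R]_(m, n) -> 'M[R]_(p, q)) X (b l : R) :
  dbound (fun v => F (unvec v)) (vec X) b l ->
  vec_differentiable F X /\
  forall u : 'cV[R]_(n * m), frob (vecJacobian F X *m u) <= l * frob u.
Proof.
pose vecL : {linear 'M[R]_(p, q) -> 'rV[R]_(q * p)} :=
  HB.pack (@vec R p q) (GRing.isLinear.Build _ _ _ _ _ (@vec_is_linear p q)).
have isom (A : 'M[R]_(p, q)) : frob (vecL A) <= 1 * frob A.
  by rewrite mul1r frob_vec.
move=> /(dbound_comp_linear ler01 isom) [df _ dl]; split => // u.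
rewrite /vecJacobian -frob_tr trmx_mul trmxK /jacobian mul_rV_lin1 -(frob_tr u).
by have := dl u^T; rewrite mul1r.
Qed.

End Vectorisation.

(** * Bounds for the attention matrix and its differential *)

Section OSA.
Variable R : realType.

(** A step is polynomial, so [dbound] is preserved with new constants. They are chosen before [f]
    and [x], hence do not depend on the weights, the input or [alpha]. *)
Lemma iter_NS_dbound k (b0 l0 : R) K : exists b l, forall N p
    (f : 'rV[R]_p -> 'M[R]_(N, k)) x, dbound f x b0 l0 ->
  dbound (fun y => iter K (@NS_step R N k) (f y)) x b l.
Proof.
elim: K => [|K [b [l IH]]]; first by exists b0, l0.
(* Both constants are read off from the [dbound] term that closes the proof. *)
eexists; eexists => N p f x /IH {}IH.
have H : (0 : R) <= 2^-1 by rewrite invr_ge0.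
exact: (dboundZ H (dboundM IH (dboundB (dbound_cst (3%:M : 'M[R]_k) x)
  (dboundM (dbound_tr IH) IH)))).
Qed.

Lemma Sproj_skew N d dv K (eps alpha : R) (WQ WK : 'M[R]_(d, dv)) (X : 'M[R]_(N, d)) :
  skew_sym (Sproj K eps alpha WQ WK X).
Proof.
rewrite /skew_sym /Sproj !trmx_mul trmxK mulmxA -mulNmx -mulmxN; congr (_ *m _ *m _).
rewrite /Sm linearZ /= -scalerN; congr (_ *: _).
by rewrite linearB /= !trmx_mul !trmxK opprB.
Qed.

Lemma Am_dbound N d dv K (eps r : R) : 0 < eps -> exists L : R,
  forall (WQ WK : 'M[R]_(d, dv)), (row_mx WQ WK)^T *m row_mx WQ WK = 1%:M ->
  forall alpha : R, 0 < alpha -> forall X : 'M[R]_(N, d), frob X <= r ->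
  Mm WQ WK X != 0 ->
  exists b, dbound (fun v => Am K eps alpha WQ WK (unvec v)) (vec X) b (alpha * L).
Proof.
move=> eps0.
(* The Frobenius norm of the orthonormal [row_mx WQ WK], hence also a bound for each block. *)
pose w : R := Num.sqrt (dv + dv)%:R.
(* The starting data [1] and [2 / eps * w] are the bounds for the normalised matrix [M0]. *)
have [bB [lB HB]] := iter_NS_dbound (dv + dv) 1 (2 / eps * w) K.
(* Here [bS], [lS] bound the commutator-like difference of products of queries and keys without its
   scalar factor, and [bT], [lT] bound its compression by [Bm]. *)
pose bS := r * w * (r * w) + r * w * (r * w).
pose lS := (r * w * w + w * (r * w)) + (r * w * w + w * (r * w)).
pose bT := bB * bS * bB.
pose lT := bB * bS * lB + (bB * lS + lB * bS) * bB.
pose c0 : R := (Num.sqrt dv%:R)^-1.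
(* This is the product rule for the three-factor term of [Am], with [0] from the constant identity.
   Each summand contains [c0 * bT] or [c0 * lT] exactly once, so replacing [c0] by [alpha * c0]
   pulls out one factor [alpha]. *)
exists (0 + (bB * (c0 * bT) * lB + (bB * (c0 * lT) + lB * (c0 * bT)) * bB)).
move=> WQ WK W1 alpha alpha0 X Xr MX.
have wW : frob (row_mx WQ WK) = w by exact: frob_isometry.
have W2 := frob_row_mxE WQ WK.
have wQ : frob WQ <= w.
  by apply: frob_le; rewrite ?sqrtr_ge0// -wW W2 lerDl sqr_ge0.
have wK : frob WK <= w.
  by apply: frob_le; rewrite ?sqrtr_ge0// -wW W2 lerDr sqr_ge0.
have lin m (W : 'M[R]_(d, m)) : frob W <= w ->
    dbound (fun v => (unvec v : 'M[R]_(N, d)) *m W) (vec X) (r * w) w.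
  move=> Ww.
  have fl : linear (fun v : 'rV[R]_(d * N) => (unvec v : 'M[R]_(N, d)) *m W).
    by move=> a u v; rewrite unvec_is_linear mulmxDl scalemxAl.
  pose fL : {linear 'rV[R]_(d * N) -> 'M[R]_(N, m)} :=
    HB.pack (fun v : 'rV[R]_(d * N) => (unvec v : 'M[R]_(N, d)) *m W)
      (GRing.isLinear.Build _ _ _ _ _ fl).
  apply: (@dbound_linear _ _ _ _ fL) => [|h] /=.
    by rewrite vecK; exact: frobM_le.
  by rewrite mulrC; apply: frobM_le => //; rewrite frob_unvec.
have dM : dbound (fun v => Mm WQ WK (unvec v : 'M[R]_(N, d))) (vec X) (r * w) w.
  have -> : (fun v => Mm WQ WK (unvec v : 'M[R]_(N, d))) =
     (fun v => (unvec v : 'M[R]_(N, d)) *m row_mx WQ WK).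
    by apply/funext => v; rewrite /Mm mul_mx_row.
  by apply: lin; rewrite wW.
have dM0 : dbound (fun v => M0 eps WQ WK (unvec v : 'M[R]_(N, d))) (vec X)
    1 (2 / eps * w).
  apply: (@dbound_lipschitz _ _ _ _ _ _ _ _ _ (r * w) w 1 (2 / eps) _ _ _ dM).
  - by rewrite divr_ge0// ltW.
  - by apply: differentiable_normalize => //; [case: dM|rewrite vecK].
  - exact: frob_normalize_le1.
  - by move=> y; exact: frob_normalize_lipschitz.
have dB : dbound (fun v => Bm K eps WQ WK (unvec v : 'M[R]_(N, d))) (vec X) bB lB.
  exact: HB dM0.
pose c := alpha / Num.sqrt dv%:R.
have c_ge0 : 0 <= c by rewrite divr_ge0 ?sqrtr_ge0// ltW.
have dT : dbound (fun v => Sproj K eps alpha WQ WK (unvec v : 'M[R]_(N, d))) (vec X)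
    (c * bT) (c * lT).
  have -> : (fun v => Sproj K eps alpha WQ WK (unvec v : 'M[R]_(N, d))) =
     (fun v => let X := unvec v : 'M[R]_(N, d) in c *: ((Bm K eps WQ WK X)^T *m
       (Qm WQ X *m (Km WK X)^T - Km WK X *m (Qm WQ X)^T) *m Bm K eps WQ WK X)).
    by apply/funext => v; rewrite /Sproj /Sm -scalemxAr -scalemxAl.
  have dQ := lin _ _ wQ; have dK := lin _ _ wK.
  exact: (dboundZ c_ge0 (dboundM (dboundM (dbound_tr dB)
    (dboundB (dboundM dQ (dbound_tr dK)) (dboundM dK (dbound_tr dQ)))) dB)).
have dE : dbound (fun v =>
    expm (Sproj K eps alpha WQ WK (unvec v : 'M[R]_(N, d))) - 1%:M) (vec X)
    (c * bT) (c * lT).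
  (* As [Sproj] is skew-symmetric at every point, the Lipschitz constant is one, and both bounds of
     [Sproj], linear in [alpha], carry over unchanged. *)
  rewrite -[c * lT]mul1r; apply: (dbound_lipschitz _ _ _ dT) => //.
  - have [dTx _ _] := dT.
    exact: (differentiableB (differentiable_comp dTx (@expm_differentiable _ _ _))
      (differentiable_cst _ _)).
  - have [_ Tb _] := dT; apply: le_trans Tb; apply: frob_expm_sub1.
    exact: Sproj_skew.
  - move=> y; rewrite mul1r opprB addrA subrK.
    by apply: expm_skew_lipschitz; exact: Sproj_skew.
have := dboundD (dbound_cst (1%:M : 'M[R]_N) (vec X))
  (dboundM (dboundM dB dE) (dbound_tr dB)).
have -> : 0 + (bB * (c * bT) * lB + (bB * (c * lT) + lB * (c * bT)) * bB) =
  alpha * (0 + (bB * (c0 * bT) * lB + (bB * (c0 * lT) + lB * (c0 * bT)) * bB)).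
  by rewrite /c /c0; ring.
by eexists; eassumption.
Qed.

End OSA.

(** * The Jacobian bound with its uniform constant *)

Theorem theorem6 (R : realType) (N d dv K : nat) (eps Rb : R) :
  (1 <= N)%N -> (1 <= d)%N -> (1 <= dv)%N ->
  (dv + dv <= d)%N -> (dv + dv <= N)%N ->
  0 < eps -> 0 < Rb ->
  exists C : R, 0 < C /\
    forall (WQ WK WV : 'M[R]_(d, dv)) (WO : 'M[R]_(dv, d)),
      (row_mx WQ WK)^T *m row_mx WQ WK = 1%:M ->
      WV^T *m WV = 1%:M ->
      WO *m WO^T = 1%:M ->
      forall (alpha : R), 0 < alpha ->
      forall X : 'M[R]_(N, d),
        specnorm X <= Rb ->
        Mm WQ WK X != 0 ->
        vec_differentiable (Am K eps alpha WQ WK) X /\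
        specnorm
          ((X *m WV *m WO *t (1%:M : 'M[R]_N))^T
             *m vecJacobian (Am K eps alpha WQ WK) X)
          <= C * alpha.
Proof.
move=> _ _ _ _ _ eps0 Rb0.
(* The Frobenius radius implied by the spectral bound on the [d] columns of [X]. *)
pose r := Num.sqrt d%:R * Rb.
have [L HL] := @Am_dbound R N d dv K eps r eps0.
pose s : R := Num.sqrt dv%:R.
(* Bounds the Frobenius norm of the Kronecker factor: [X], [WV], [WO] and the identity of size [N]
   contribute one factor each. *)
pose P := r * s * s * Num.sqrt N%:R.
have P0 : 0 <= P by rewrite !mulr_ge0 ?sqrtr_ge0 ?ltW.
(* The sign of [L] is not known, so its absolute value is taken; the [+ 1] makes the constant
   strictly positive. *)
exists (P * `|L| + 1); split; first by rewrite ltr_wpDl// mulr_ge0.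
move=> WQ WK WV WO W1 V1 O1 alpha alpha0 X XR MX.
have Xr : frob X <= r by apply: frob_le_specnorm => //; exact: ltW.
have [b /vecJacobian_bound[dA JA]] := HL _ _ W1 _ alpha0 _ Xr MX.
split => //; apply: specnorm_le => v v1; rewrite -[_ *m v]mulmxA.
have wV : frob WV <= s by rewrite (frob_isometry V1).
have wO : frob WO <= s by rewrite -frob_tr frob_isometry// trmxK.
apply: (@le_trans _ _ (P * (alpha * `|L|))).
  apply: frobM_le.
    rewrite frob_tr frob_tens frob1 ler_wpM2r ?sqrtr_ge0//.
    by do 2!apply: frobM_le => //.
  apply: le_trans (JA v) _; apply: (@le_trans _ _ (alpha * `|L| * frob v)).
    by rewrite ler_wpM2r// ler_wpM2l ?ler_norm// ltW.
  by rewrite ler_piMr// mulr_ge0// ltW.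
by rewrite mulrCA mulrC ler_wpM2r ?lerDl// ltW.
Qed.
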